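(* Let $X$ be a set, let $\mathcal{A}$ and $\mathcal{B}$ be unital $C^*$-algebras, and let $k: X\times X\to\mathcal{L}(\mathcal{A},\mathcal{B})$ be a kernel. Let $\mathcal{C}$ be the collection of all subsets $Y\subset X$ such that the restriction $k|_Y$ of $k$ to $Y\times Y$ is uniformly regular, partially ordered by inclusion. Then there exists a chain $\mathcal{C}_0\subset\mathcal{C}$ (a totally ordered subcollection) such that $$\bigcup_{Y\in\mathcal{C}_0}Y=X$$ if and only if $k$ is regular.
   Context: $\mathcal{L}(\mathcal{A},\mathcal{B})$ is the space of bounded linear maps from $\mathcal{A}$ to $\mathcal{B}$; a kernel on a set $X$ is a function $k: X\times X\to\mathcal{L}(\mathcal{A},\mathcal{B})$, and $k(x,y)[a]$ denotes the value of the map $k(x,y)$ at $a\in\mathcal{A}$. For a finite subset $F=\{x_1,\dots,x_n\}\subset X$, the entrywise map $(k(x_i,x_j)): M_n(\mathcal{A})\to M_n(\mathcal{B})$ is $(a_{i,j})\mapsto (k(x_i,x_j)[a_{i,j}])$. The kernel $k$ is completely bounded if for every finite $F\subset X$ this entrywise map is completely bounded; it is completely contractive if for every finite $F\subset X$ this entrywise map is completely bounded with cb-norm at most $1$. A completely bounded kernel $k$ on $X$ is regular if there is a scalar-valued map $c: X\to(0,1]$ such that the kernel $\tilde k(x,y)[a]:=c(x)\,k(x,y)[a]\,\overline{c(y)}$ is completely contractive. It is uniformly regular if it is regular and there exist $\alpha\in(0,1]$ and a choice of $c:X\to[\alpha,1]$ such that $\tilde k(x,y)[a]:=c(x)\,k(x,y)[a]\,\overline{c(y)}$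 is completely contractive. For the restriction $k|_Y$ these notions are understood with $Y$ as the index set. *)

(* Defs.v *)
From HB Require Import structures.
From mathcomp Require Import all_boot all_order all_algebra.
From mathcomp Require Import complex.
From mathcomp Require Import all_classical all_reals all_analysis.

Set Implicit Arguments.
Unset Strict Implicit.
Unset Printing Implicit Defensive.
Import Order.TTheory GRing.Theory Num.Theory numFieldNormedType.Exports.

Local Open Scope classical_set_scope.
Local Open Scope ring_scope.
Local Open Scope complex_scope.

(* The complex numbers are R[i], for R : realType. Norms of normed modules over
   R[i] take their values in R[i]; they are real, and [rnorm] views them in R. *)
Definition rnorm (R : realType) (V : normedModType R[i]) (v : V) : R :=
  complex.Re `|v|.

(* A unital C*-algebra over the Banach space A. The product and the unit are
   fields of the mixin rather than inherited from [algType]: Hierarchy Builder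
   rejects a structure joining a ring with a module normed over another field
   (a missing join with [numDomainType]). *)
HB.mixin Record isCStarAlgebra (R : realType) A of CompleteNormedModule R[i] A := {
  cmul : A -> A -> A;
  cone : A;
  star : A -> A;
  cmulA : associative cmul;
  cmul1a : left_id cone cmul;
  cmula1 : right_id cone cmul;
  cmulDl : left_distributive cmul +%R;
  cmulDr : right_distributive cmul +%R;
  cmulZl : forall (z : R[i]) (a b : A), cmul (z *: a) b = z *: cmul a b;
  cmulZr : forall (z : R[i]) (a b : A), cmul a (z *: b) = z *: cmul a b;
  starK : involutive star;
  starD : {morph star : a b / a + b};
  starZ : forall (z : R[i]) (a : A), star (z *: a) = z^* *: star a;
  starM : forall a b : A, star (cmul a b) = cmul (star b) (star a);
  ler_norm_cmul : forall a b : A, `|cmul a b| <= `|a| * `|b|;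
  cstar_identity : forall a : A, `|cmul (star a) a| = `|a| ^+ 2
}.

#[short(type="cstarAlgType")]
HB.structure Definition CStarAlgebra (R : realType) :=
  {A of CompleteNormedModule R[i] A & isCStarAlgebra R A}.

HB.mixin Record isHilbert (R : realType) H of CompleteNormedModule R[i] H := {
  inner : {dot H for (@Num.Def.conjC R[i])};
  inner_norm : forall v : H, `|v| ^+ 2 = inner v v
}.

#[short(type="hilbertType")]
HB.structure Definition Hilbert (R : realType) :=
  {H of CompleteNormedModule R[i] H & isHilbert R H}.

Record bounded_linear (K : numFieldType) (V W : normedModType K) :=
  BoundedLinear {
    bl_fun :> {linear V -> W};
    bl_bounded : exists M : K, forall v : V, `|bl_fun v| <= M * `|v|
  }.

Lemma bl_scale_subproof (K : numFieldType) (V W : normedModType K) (z : K)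
    (f : bounded_linear V W) :
  exists M : K, forall v : V, `|(z \*: bl_fun f) v| <= M * `|v|.
Proof.
have [M fM] := bl_bounded f.
by exists (`|z| * M) => v; rewrite /= normrZ -mulrA ler_wpM2l.
Qed.

Definition bl_scale (K : numFieldType) (V W : normedModType K) (z : K)
    (f : bounded_linear V W) : bounded_linear V W :=
  BoundedLinear (bl_scale_subproof z f).

Record representation (R : realType) (A : cstarAlgType R) (H : hilbertType R) :=
  Representation {
    rep :> A -> bounded_linear H H;
    repD : forall a b v, rep (a + b) v = rep a v + rep b v;
    repZ : forall (z : R[i]) a v, rep (z *: a) v = z *: rep a v;
    repM : forall a b v, rep (cmul a b) v = rep a (rep b v);
    rep1 : forall v, rep cone v = v;
    rep_star : forall a u v, inner (rep a u) v = inner u (rep (star a) v)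
  }.

Definition l2norm (R : realType) (H : hilbertType R) (I : finType)
    (xi : I -> H) : R :=
  Num.sqrt (\sum_i rnorm (xi i) ^+ 2).

(* The C*-norm of the matrix algebra over A with (finite) index set I: the
   supremum, over all unital *-representations pi of A on a Hilbert space H, of
   the operator norm of (pi (T i j)) on the direct sum of I copies of H. By
   Gelfand-Naimark some pi is isometric, and any such pi attains this supremum,
   since *-homomorphisms of C*-algebras are contractive. *)
Definition cstar_mxnorm (R : realType) (A : cstarAlgType R) (I : finType)
    (T : I -> I -> A) : \bar R :=
  ereal_sup [set r | exists (H : hilbertType R) (pi : representation A H)
    (xi : I -> H), l2norm xi <= 1 /\
      r = (l2norm (fun i => \sum_j pi (T i j) (xi j)))%:E].

(* M_m(M_n(A)) is the matrix algebra over A with index set 'I_m * 'I_n. *)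
Definition mxmx_norm (R : realType) (A : cstarAlgType R) (m n : nat)
    (T : 'M['M[A]_n]_m) : \bar R :=
  cstar_mxnorm (fun p q : 'I_m * 'I_n => T p.1 q.1 p.2 q.2).

(* [map_mx phi] on m x m matrices is the m-th amplification of phi. *)
Definition cb_norm (R : realType) (A B : cstarAlgType R) (n : nat)
    (phi : 'M[A]_n -> 'M[B]_n) : \bar R :=
  ereal_sup [set r | exists (m : nat) (T : 'M['M[A]_n]_m),
    (mxmx_norm T <= 1)%E /\ r = mxmx_norm (map_mx phi T)].

Definition completely_bounded (R : realType) (A B : cstarAlgType R) (n : nat)
    (phi : 'M[A]_n -> 'M[B]_n) : Prop :=
  (cb_norm phi < +oo)%E.

Definition completely_contractive (R : realType) (A B : cstarAlgType R)
    (n : nat) (phi : 'M[A]_n -> 'M[B]_n) : Prop :=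
  completely_bounded phi /\ (cb_norm phi <= 1)%E.

Definition opkernel (R : realType) (X : Type) (A B : cstarAlgType R) : Type :=
  X -> X -> bounded_linear A B.

Definition entrywise (R : realType) (X : Type) (A B : cstarAlgType R)
    (k : opkernel X A B) (n : nat) (x : 'I_n -> X) (a : 'M[A]_n) : 'M[B]_n :=
  \matrix_(i, j) k (x i) (x j) (a i j).

(* Finite subsets of X are enumerated without repetition. *)
Definition cb_kernel (R : realType) (X : Type) (A B : cstarAlgType R)
    (k : opkernel X A B) : Prop :=
  forall (n : nat) (x : 'I_n -> X), injective x ->
    completely_bounded (entrywise k x).

Definition cc_kernel (R : realType) (X : Type) (A B : cstarAlgType R)
    (k : opkernel X A B) : Prop :=
  forall (n : nat) (x : 'I_n -> X), injective x ->
    completely_contractive (entrywise k x).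

Definition scale_kernel (R : realType) (X : Type) (A B : cstarAlgType R)
    (c : X -> R) (k : opkernel X A B) : opkernel X A B :=
  fun x y => bl_scale ((c x)%:C * ((c y)%:C)^*) (k x y).

Definition regular (R : realType) (X : Type) (A B : cstarAlgType R)
    (k : opkernel X A B) : Prop :=
  cb_kernel k /\
  exists c : X -> R, (forall x, 0 < c x <= 1) /\ cc_kernel (scale_kernel c k).

Definition uniformly_regular (R : realType) (X : Type) (A B : cstarAlgType R)
    (k : opkernel X A B) : Prop :=
  regular k /\
  exists alpha : R, 0 < alpha <= 1 /\
  exists c : X -> R,
    (forall x, alpha <= c x <= 1) /\ cc_kernel (scale_kernel c k).

Definition restrict_kernel (R : realType) (X : Type) (A B : cstarAlgType R)
    (k : opkernel X A B) (Y : set X) : opkernel Y A B :=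
  fun x y => k (val x) (val y).

Arguments restrict_kernel {R X A B} k Y x y.

(* Main.v *)
Require Import Defs.
From HB Require Import structures.
From mathcomp Require Import all_boot all_order all_algebra.
From mathcomp Require Import complex.
From mathcomp Require Import all_classical all_reals all_analysis.
From mathcomp Require Import ring lra.

Set Implicit Arguments.
Unset Strict Implicit.
Unset Printing Implicit Defensive.
Import Order.TTheory GRing.Theory Num.Theory numFieldNormedType.Exports.

Local Open Scope classical_set_scope.
Local Open Scope ring_scope.

(** If c makes the scaled kernel completely contractive, the superlevel sets
    {x | a <= c x}, for 0 < a <= 1, form a chain that covers X, and c itself
    witnesses uniform regularity on each of them.

    Conversely, let C0 be a chain of uniformly regular sets covering X. If
    alpha <= c on Y and c k c is completely contractive there, dividing c out
    again on both sides shows that every finite submatrix of k over Y has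
    cb-norm at most alpha^-2: a bound that depends on Y only
    ([uniformly_regular_cb_bound]). So each point x lies in some member of C0
    with squared bound lev x + 1, where lev x is a natural number. However large
    the chain is, only countably many levels occur, and finitely many points of
    level at most N all lie in one member of the chain, whose squared bound is
    at most N + 1 ([finite_chain_max]). It remains to see that a kernel with the
    squared bound N + 1 on each set {lev <= N} becomes completely contractive
    after scaling by
      weight l = 2^-(l+1) / (l+1)
    ([mxbound_weight]). A matrix over the kernel is cut into blocks according to
    the levels of its rows and columns. The block (a, b) has squared norm at
    most max(a, b) + 1 <= (a + 1)(b + 1), which the denominators of the weights
    absorb, and the factors 2^-(l+1), with sum at most 1, add the blocks up.

    The estimates bound squared l2-norms, one representation at a time
    ([mxbound]), so that Jensen's inequality for the convex function t^2 takes
    the place of the triangle inequality in l2. Square roots are left to the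
    translation from and to the C*-norm and the cb-norm. *)

(** * Real-valued norms and Jensen's inequality *)

Section Rnorm.
Variables (R : realType) (V : normedModType R[i]).
Implicit Types (u v : V) (r : R).

Lemma rnormE v : `|v| = (rnorm v)%:C%C.
Proof.
have := normr_ge0 v; rewrite /rnorm.
by case: `|v| => a b; rewrite lecE /= => /andP[/eqP -> _].
Qed.

Lemma rnorm_ge0 v : 0 <= rnorm v.
Proof. by have := normr_ge0 v; rewrite rnormE lecR. Qed.

Lemma rnorm0 : rnorm (0 : V) = 0.
Proof. by rewrite /rnorm normr0. Qed.

Lemma rnorm_eq0 v : rnorm v = 0 -> v = 0.
Proof. by move=> v0; apply/eqP; rewrite -normr_eq0 rnormE v0. Qed.

Lemma rnormZ r v : rnorm (r%:C%C *: v) = `|r| * rnorm v.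
Proof.
have rC : `|r%:C%C| = (`|r|)%:C%C.
  by rewrite normc_def /= expr0n addr0 sqrtr_sqr.
by rewrite {1}/rnorm normrZ rC rnormE -rmorphM.
Qed.

Lemma ler_rnorm_sum (I : finType) (P : pred I) (F : I -> V) :
  rnorm (\sum_(i | P i) F i) <= \sum_(i | P i) rnorm (F i).
Proof.
rewrite -lecR -rnormE rmorph_sum /=; apply: le_trans (ler_norm_sum _ _ _) _.
by rewrite le_eqVlt; apply/orP; left; apply/eqP/eq_bigr => i _; rewrite rnormE.
Qed.

(** Jensen's inequality for t^2. The weights have total mass at most 1 rather
    than exactly 1; it follows from the variance about the weighted sum [mu]
    being nonnegative. *)
Lemma sqr_wsum_le (I : finType) (w t : I -> R) :
  (forall i, 0 <= w i) -> \sum_i w i <= 1 ->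
  (\sum_i w i * t i) ^+ 2 <= \sum_i w i * t i ^+ 2.
Proof.
move=> w0 w1; set mu := \sum_i _.
have var_ge0 : 0 <= \sum_i w i * (t i - mu) ^+ 2.
  by apply: sumr_ge0 => i _; rewrite mulr_ge0 // sqr_ge0.
have varE : \sum_i w i * (t i - mu) ^+ 2 =
    \sum_i w i * t i ^+ 2 - 2 * mu * mu + mu ^+ 2 * \sum_i w i.
  under eq_bigr => i _.
    have -> : w i * (t i - mu) ^+ 2 =
      w i * t i ^+ 2 - 2 * mu * (w i * t i) + mu ^+ 2 * w i by ring.
    over.
  by rewrite big_split /= sumrB -!mulr_sumr.
have := ler_wpM2l (sqr_ge0 mu) w1.
by rewrite varE in var_ge0; nra.
Qed.

Lemma sqr_rnorm_wsum_le (I : finType) (w : I -> R) (v : I -> V) :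
  (forall i, 0 <= w i) -> \sum_i w i <= 1 ->
  rnorm (\sum_i (w i)%:C%C *: v i) ^+ 2 <= \sum_i w i * rnorm (v i) ^+ 2.
Proof.
move=> w0 w1; apply: le_trans (sqr_wsum_le _ w0 w1).
rewrite lerXn2r ?nnegrE ?rnorm_ge0 ?sumr_ge0 //.
  by move=> i _; rewrite mulr_ge0 ?rnorm_ge0.
apply: le_trans (ler_rnorm_sum _ _) _.
by apply: ler_sum => i _; rewrite rnormZ ger0_norm.
Qed.

End Rnorm.

(** * Bounds on matrices over a C*-algebra *)

Section L2norm.
Variables (R : realType) (H : hilbertType R) (I : finType).
Implicit Type xi : I -> H.

Lemma sum_sqr_rnorm xi :
  \sum_(j in [set: I]%SET) rnorm (xi j) ^+ 2 = l2norm xi ^+ 2.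
Proof.
rewrite /l2norm sqr_sqrtr ?sumr_ge0 //; last by move=> *; rewrite sqr_ge0.
by apply: eq_bigl => j; exact: finset.in_setT.
Qed.

Lemma l2norm_eq0 xi : l2norm xi = 0 -> forall j, xi j = 0.
Proof.
move/eqP; rewrite sqrtr_eq0 => xi0 j; apply: rnorm_eq0.
have : \sum_i rnorm (xi i) ^+ 2 == 0.
  by rewrite eq_le xi0 sumr_ge0 // => *; rewrite sqr_ge0.
rewrite psumr_eq0; last by move=> *; rewrite sqr_ge0.
by move/allP/(_ j (mem_index_enum j)); rewrite /= sqrf_eq0 => /eqP.
Qed.

Lemma l2normZ (r : R) xi : 0 <= r ->
  l2norm (fun i => r%:C%C *: xi i) = r * l2norm xi.
Proof.
move=> r0; rewrite /l2norm.
under eq_bigr do rewrite rnormZ exprMn real_normK ?num_real //.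
by rewrite -mulr_sumr sqrtrM ?sqr_ge0 // sqrtr_sqr ger0_norm.
Qed.

End L2norm.

Section Bounds.
Variable R : realType.

(** The compression of the matrix S to the rows and columns in q has squared
    norm at most M. Compressing by an index set q, instead of forming a
    submatrix, keeps all blocks of one matrix over one index type. *)
Definition mxbound (A : cstarAlgType R) (I : finType) (q : {set I})
    (S : I -> I -> A) (M : R) : Prop :=
  forall (H : hilbertType R) (pi : representation A H) (xi : I -> H),
    \sum_(i in q) rnorm (\sum_(j in q) pi (S i j) (xi j)) ^+ 2
      <= M * \sum_(i in q) rnorm (xi i) ^+ 2.

(** The supremum defining [cstar_mxnorm] ranges over vectors of norm at most 1;
    by homogeneity it controls all vectors. *)
Lemma cstar_mxnorm_leP (A : cstarAlgType R) (I : finType) (S : I -> I -> A)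
    (C : R) : 0 <= C ->
  (cstar_mxnorm S <= C%:E)%E <-> mxbound [set: I]%SET S (C ^+ 2).
Proof.
move=> C0.
have sumT (H : hilbertType R) (F : I -> H) (pi : representation A H) i :
    \sum_(j in [set: I]%SET) pi (S i j) (F j) = \sum_j pi (S i j) (F j).
  by apply: eq_bigl => j; exact: finset.in_setT.
split=> [SC H pi xi|SC].
  under eq_bigr do rewrite sumT.
  rewrite !sum_sqr_rnorm -exprMn lerXn2r ?nnegrE ?mulr_ge0 ?sqrtr_ge0 //.
  have [xi0|xi0] := eqVneq (l2norm xi) 0.
    have xi_eq0 := l2norm_eq0 xi0.
    rewrite xi0 mulr0 /l2norm big1 ?sqrtr0 // => i _.
    by rewrite big1 ?rnorm0 ?expr0n // => j _; rewrite xi_eq0 linear0.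
  have l_gt0 : 0 < l2norm xi by rewrite lt_def xi0 sqrtr_ge0.
  set l := l2norm xi in l_gt0 *.
  (* Apply the supremum to the normalized vector. *)
  have : ((l2norm (fun i => \sum_j pi (S i j) ((l^-1)%:C%C *: xi j)))%:E
      <= C%:E)%E.
    apply: le_trans SC; apply: ereal_sup_ubound.
    exists H, pi, (fun j => (l^-1)%:C%C *: xi j); split=> //.
    by rewrite l2normZ ?invr_ge0 ?(ltW l_gt0) // mulVf ?gt_eqF.
  have -> : (fun i => \sum_j pi (S i j) ((l^-1)%:C%C *: xi j)) =
      (fun i => (l^-1)%:C%C *: \sum_j pi (S i j) (xi j)).
    apply: funext => i; rewrite scaler_sumr.
    by apply: eq_bigr => j _; rewrite linearZ.
  rewrite l2normZ ?invr_ge0 ?(ltW l_gt0) // lee_fin.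
  by rewrite mulrC ler_pdivrMr.
apply: ge_ereal_sup => _ [H [pi [xi [xi1 ->]]]]; rewrite lee_fin.
have := SC H pi xi; under eq_bigr do rewrite sumT.
rewrite !sum_sqr_rnorm -exprMn ler_pXn2r ?nnegrE ?mulr_ge0 ?sqrtr_ge0 //.
move=> /le_trans; apply; rewrite -[leRHS]mulr1; exact: ler_wpM2l.
Qed.

Lemma mxbound_reindex (A : cstarAlgType R) (I J : finType) (f : J -> I)
    (S : I -> I -> A) (M : R) : injective f ->
  mxbound (f @: [set: J])%SET S M <->
  mxbound [set: J]%SET (fun i j => S (f i) (f j)) M.
Proof.
move=> f_inj.
have fin : {in [set: J]%SET &, injective f} by move=> ? ? _ _; exact: f_inj.
have reidx (V : zmodType) (F : I -> V) :
    \sum_(i in (f @: [set: J])%SET) F i = \sum_(j in [set: J]%SET) F (f j).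
  exact: big_imset.
split=> SM H pi xi; last first.
  rewrite !reidx; under eq_bigr do rewrite reidx.
  exact: SM.
(* Transport of xi to the image of f, extended by zero. *)
pose eta i := if [pick j | f j == i] is Some j then xi j else 0.
have etaf j : eta (f j) = xi j.
  rewrite /eta; case: pickP => [j' /eqP/f_inj -> //|/(_ j)]; by rewrite eqxx.
have := SM H pi eta.
rewrite !reidx; under eq_bigr do rewrite reidx.
under eq_bigr do under eq_bigr do rewrite etaf.
by under [X in _ <= _ * X -> _]eq_bigr do rewrite etaf.
Qed.

(** Extend vectors by zero from p to q and drop the rows outside p. *)
Lemma mxbound_mono (A : cstarAlgType R) (I : finType) (p q : {set I})
    (S : I -> I -> A) (M : R) : p \subset q -> mxbound q S M -> mxbound p S M.
Proof.
move=> pq SM H pi xi.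
pose eta i := if i \in p then xi i else 0.
have big_sub (V : zmodType) (F : I -> V) : (forall i, i \notin p -> F i = 0) ->
    \sum_(i in q) F i = \sum_(i in p) F i.
  move=> F0; rewrite (finset.big_setID p) /= (finset.setIidPr pq).
  rewrite [X in _ + X]big1 ?addr0 // => i.
  by rewrite finset.in_setD => /andP[/F0].
have := SM H pi eta.
rewrite [X in _ <= _ * X]big_sub; last first.
  by move=> i /negPf ip; rewrite /eta ip rnorm0 expr0n.
have -> : \sum_(i in p) rnorm (eta i) ^+ 2 = \sum_(i in p) rnorm (xi i) ^+ 2.
  by apply: eq_bigr => i ip; rewrite /eta ip.
apply: le_trans.
have inner i :
    \sum_(j in q) pi (S i j) (eta j) = \sum_(j in p) pi (S i j) (xi j).
  rewrite big_sub => [|j /negPf jp]; last by rewrite /eta jp linear0.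
  by apply: eq_bigr => j jp; rewrite /eta jp.
under [leRHS]eq_bigr do rewrite inner.
rewrite [leRHS](finset.big_setID p) /= (finset.setIidPr pq) lerDl.
by apply: sumr_ge0 => *; rewrite sqr_ge0.
Qed.

(** Each of the two diagonal factors u has norm at most b, and M bounds a squared
    norm: hence the fourth power. *)
Lemma mxbound_scale (A : cstarAlgType R) (I : finType) (q : {set I})
    (S : I -> I -> A) (M b : R) (u : I -> R) :
  0 <= M -> (forall i, `|u i| <= b) -> mxbound q S M ->
  mxbound q (fun i j => (u i * u j)%:C%C *: S i j) (b ^+ 4 * M).
Proof.
move=> M0 ub SM H pi xi.
have sqr_le (v : H) i : rnorm ((u i)%:C%C *: v) ^+ 2 <= b ^+ 2 * rnorm v ^+ 2.
  rewrite rnormZ exprMn ler_wpM2r ?sqr_ge0 // lerXn2r ?nnegrE //.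
  exact: le_trans (ub i).
have inner i : \sum_(j in q) pi ((u i * u j)%:C%C *: S i j) (xi j) =
    (u i)%:C%C *: \sum_(j in q) pi (S i j) ((u j)%:C%C *: xi j).
  rewrite scaler_sumr; apply: eq_bigr => j _.
  by rewrite repZ linearZ /= scalerA rmorphM.
under eq_bigr do rewrite inner.
apply: le_trans (ler_sum _ _) _ => [i _|]; first exact: sqr_le.
rewrite -mulr_sumr (_ : b ^+ 4 * M = b ^+ 2 * (M * b ^+ 2)); last by ring.
rewrite -mulrA ler_wpM2l ?sqr_ge0 //; apply: le_trans (SM H pi _) _.
rewrite -mulrA ler_wpM2l // mulr_sumr.
by apply: ler_sum => i _; exact: sqr_le.
Qed.

(** * The block estimate *)

Lemma sum_half_pow n : \sum_(a < n) (2^-1 : R) ^+ a.+1 <= 1.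
Proof.
have -> : \sum_(a < n) (2^-1 : R) ^+ a.+1 = 1 - 2^-1 ^+ n.
  elim: n => [|n IH]; first by rewrite big_ord0 expr0 subrr.
  by rewrite big_ord_recr /= IH exprS; field.
by rewrite gerBl exprn_ge0 // invr_ge0.
Qed.

(** The first factor makes the sum over the levels converge; the second pays for
    the growth of the bound with the level. *)
Definition weight (n : nat) : R := 2^-1 ^+ n.+1 / n.+1%:R.

Lemma weight_itv n : 0 < weight n <= 1.
Proof.
rewrite /weight; apply/andP; split.
  by rewrite divr_gt0 // exprn_gt0 // invr_gt0.
rewrite ler_pdivrMr // mul1r (@le_trans _ _ 1) ?ler1n //.
by rewrite exprn_ile1 ?invr_ge0 // invf_le1 ?ler1n.
Qed.

(** Cut S into blocks by the levels a of the rows and b of the columns. The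
    block (a, b) sits in the compression of S to levels at most max(a, b), so its
    squared norm is at most max(a, b) + 1 <= (a + 1)(b + 1). Jensen's inequality
    in b followed by summation over a gives a total of at most
    \sum_a \sum_b 2^-(a+1) 2^-(b+1) <= 1. *)
Lemma mxbound_weight (A : cstarAlgType R) (I : finType) (S : I -> I -> A)
    (lev : I -> nat) :
  (forall N, mxbound [set i | (lev i <= N)%N]%SET S N.+1%:R) ->
  mxbound [set: I]%SET
    (fun i j => (weight (lev i) * weight (lev j))%:C%C *: S i j) 1.
Proof.
move=> SM H pi xi; rewrite mul1r.
pose n := (\max_i lev i).+1.
have lev_lt i : (lev i < n)%N by rewrite ltnS; exact: leq_bigmax.
pose l i : 'I_n := Ordinal (lev_lt i).
have sumT (V : zmodType) (F : I -> V) :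
    \sum_(i in [set: I]%SET) F i = \sum_i F i.
  by apply: eq_bigl => i; rewrite finset.in_setT.
rewrite !sumT; under eq_bigr do rewrite sumT.
pose w (a : 'I_n) : R := 2^-1 ^+ a.+1.
have w_ge0 a : 0 <= w a by rewrite exprn_ge0 // invr_ge0.
have w_le1 a : w a <= 1 by rewrite exprn_ile1 ?invr_ge0 // invf_le1 ?ler1n.
have w_sum : \sum_a w a <= 1 := sum_half_pow n.
pose K (a : 'I_n) : R := a.+1%:R.
have K_gt0 a : 0 < K a by rewrite ltr0n.
pose blk i (b : 'I_n) : H := \sum_(j | l j == b) pi (S i j) (xi j).
set E := \sum_i rnorm (xi i) ^+ 2.
have E_ge0 : 0 <= E by apply: sumr_ge0 => *; rewrite sqr_ge0.
(* Row i as a combination with the weights w b, to which Jensen applies. *)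
have row i :
    \sum_j pi ((weight (lev i) * weight (lev j))%:C%C *: S i j) (xi j) =
    (w (l i) / K (l i))%:C%C *: \sum_b (w b)%:C%C *: ((K b)^-1%:C%C *: blk i b).
  rewrite (partition_big l xpredT) //= scaler_sumr; apply: eq_bigr => b _.
  rewrite /blk !scaler_sumr; apply: eq_bigr => j /eqP <-.
  by rewrite repZ !scalerA -!rmorphM /= /weight -mulrA.
have block a b : \sum_(i | l i == a) rnorm (blk i b) ^+ 2 <= K a * K b * E.
  pose N := maxn a b.
  (* Feeding the level-b part of xi to the compression yields the blocks. *)
  pose eta j := if l j == b then xi j else 0.
  have etaE i :
      \sum_(j in [set i | (lev i <= N)%N]%SET) pi (S i j) (eta j) = blk i b.
    rewrite /blk big_mkcond [RHS]big_mkcond; apply: eq_bigr => j _.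
    rewrite finset.inE /eta.
    case: eqP => [jb|_]; last by rewrite linear0 if_same.
    by rewrite /N -jb leq_maxr.
  have := SM N H pi eta; under eq_bigr do rewrite etaE.
  move=> bnd.
  have NK : N.+1%:R <= K a * K b.
    by rewrite -natrM ler_nat /N -maxnSS geq_max leq_pmulr // leq_pmull.
  apply: le_trans (_ : _ <= N.+1%:R * E) _; last by rewrite ler_wpM2r.
  apply: le_trans (le_trans bnd _).
    rewrite [leLHS]big_mkcond [leRHS]big_mkcond; apply: ler_sum => i _.
    rewrite finset.inE; case: eqP => [ia|_]; first by rewrite /N -ia leq_maxl.
    by case: ifP => // _; rewrite sqr_ge0.
  rewrite ler_wpM2l // big_mkcond; apply: ler_sum => i _.
  rewrite /eta; case: ifP => _; last by rewrite sqr_ge0.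
  by case: ifP => // _; rewrite rnorm0 expr0n sqr_ge0.
under eq_bigr do rewrite row.
rewrite (partition_big l xpredT) //=.
have rowle a : \sum_(i | l i == a)
    rnorm ((w (l i) / K (l i))%:C%C *:
       \sum_b (w b)%:C%C *: ((K b)^-1%:C%C *: blk i b)) ^+ 2 <=
    \sum_b (w a / K a) ^+ 2 * (w b * ((K b)^-1 ^+ 2 * (K a * K b * E))).
  apply: le_trans (_ : _ <= \sum_(i | l i == a) \sum_b (w a / K a) ^+ 2 *
     (w b * ((K b)^-1 ^+ 2 * rnorm (blk i b) ^+ 2))) _.
    apply: ler_sum => i /eqP <-.
    rewrite rnormZ exprMn real_normK ?num_real // -mulr_sumr.
    rewrite ler_wpM2l ?sqr_ge0 //.
    apply: le_trans (sqr_rnorm_wsum_le _ w_ge0 w_sum) _.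
    apply: ler_sum => b _.
    by rewrite rnormZ exprMn real_normK ?num_real.
  rewrite exchange_big; apply: ler_sum => b _ /=.
  by rewrite -!mulr_sumr !ler_wpM2l ?sqr_ge0.
apply: le_trans (ler_sum _ (fun a _ => rowle a)) _.
apply: le_trans (_ : _ <= \sum_a \sum_b w a * (w b * E)) _.
  apply: ler_sum => a _; apply: ler_sum => b _.
  (* What remains beside w a * w b * E is a product of numbers in [0, 1]. *)
  have -> : (w a / K a) ^+ 2 * (w b * ((K b)^-1 ^+ 2 * (K a * K b * E))) =
     w a * (w b * E) * (w a * ((K a)^-1 * (K b)^-1)).
    by field; rewrite !gt_eqF.
  rewrite -[leRHS]mulr1 ler_wpM2l ?mulr_ge0 //.
  have Kinv c : 0 <= (K c)^-1 <= 1.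
    by rewrite invr_ge0 ltW //= invf_le1 // ler1n.
  have /andP[? ?] := Kinv a; have /andP[? ?] := Kinv b.
  by rewrite !mulr_ile1 ?mulr_ge0.
under eq_bigr do rewrite -mulr_sumr -mulr_suml.
rewrite -mulr_suml mulrA -[leRHS]mul1r ler_wpM2r //.
by rewrite mulr_ile1 ?sumr_ge0.
Qed.

End Bounds.

(** * Bounds on kernels *)

Section Kernels.
Variables (R : realType) (A B : cstarAlgType R).

(** M_m(M_n(C)) as matrices indexed by pairs, the form in which [mxmx_norm]
    takes their norm. *)
Definition mxflat (C : cstarAlgType R) m n (T : 'M['M[C]_n]_m) :
    'I_m * 'I_n -> 'I_m * 'I_n -> C :=
  fun p q => T p.1 q.1 p.2 q.2.

(** A bound on the square of the cb-norm. *)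
Definition cb_bound n (phi : 'M[A]_n -> 'M[B]_n) (M : R) : Prop :=
  forall m (T : 'M['M[A]_n]_m), (mxmx_norm T <= 1)%E ->
    mxbound [set: 'I_m * 'I_n]%SET (mxflat (map_mx phi T)) M.

Lemma cb_boundP n (phi : 'M[A]_n -> 'M[B]_n) (M : R) : 0 <= M ->
  cb_bound phi M <-> (cb_norm phi <= (Num.sqrt M)%:E)%E.
Proof.
move=> M0; split=> [phiM|phiM m T T1].
  apply: ge_ereal_sup => _ [m [T [T1 ->]]].
  by apply/cstar_mxnorm_leP; rewrite ?sqrtr_ge0 ?sqr_sqrtr //; exact: phiM.
rewrite -[M]sqr_sqrtr //; apply/cstar_mxnorm_leP; first exact: sqrtr_ge0.
by apply: le_trans phiM; apply: ereal_sup_ubound; exists m, T.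
Qed.

Lemma completely_contractiveP n (phi : 'M[A]_n -> 'M[B]_n) :
  completely_contractive phi <-> cb_bound phi 1.
Proof.
have -> : cb_bound phi 1 <-> (cb_norm phi <= 1)%E.
  by rewrite -[1%E](congr1 EFin (@sqrtr1 R)); exact: cb_boundP.
split=> [[]//|phi1]; split=> //.
by apply: le_lt_trans phi1 _; rewrite ltry.
Qed.

Lemma cb_bound_completely_bounded n (phi : 'M[A]_n -> 'M[B]_n) (M : R) :
  0 <= M -> cb_bound phi M -> completely_bounded phi.
Proof.
by move=> M0 /(cb_boundP _ M0) phiM; apply: le_lt_trans phiM _; rewrite ltry.
Qed.

Section Scaling.
Variables (X : Type) (k : opkernel X A B).

Lemma mxflat_scale_kernel (c : X -> R) n (x : 'I_n -> X) m
    (T : 'M['M[A]_n]_m) :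
  mxflat (map_mx (entrywise (scale_kernel c k) x) T) =
  fun p q => (c (x p.2) * c (x q.2))%:C%C *:
    mxflat (map_mx (entrywise k x) T) p q.
Proof.
apply/funext => p; apply/funext => q.
have conj_real (r : R) : Num.conj r%:C%C = r%:C%C := conjc_real r.
by rewrite /mxflat !mxE /= conj_real -rmorphM.
Qed.

Lemma cb_bound_unscale (c : X -> R) (a : R) n (x : 'I_n -> X) :
  0 < a -> (forall i, a <= c (x i)) ->
  cb_bound (entrywise (scale_kernel c k) x) 1 ->
  cb_bound (entrywise k x) (a^-1 ^+ 4).
Proof.
move=> a0 ac phi1 m T /phi1; rewrite mxflat_scale_kernel => ck1.
have c0 i : 0 < c (x i) by exact: lt_le_trans (ac i).
have cV_le (p : 'I_m * 'I_n) : `|(c (x p.2))^-1| <= a^-1.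
  by rewrite gtr0_norm ?invr_gt0 // lef_pV2 ?posrE.
have := mxbound_scale ler01 cV_le ck1; rewrite mulr1.
suff /funext-> : (fun p q => ((c (x p.2))^-1 * (c (x q.2))^-1)%:C%C *:
  ((c (x p.2) * c (x q.2))%:C%C *: mxflat (map_mx (entrywise k x) T) p q)) =1
  mxflat (map_mx (entrywise k x) T) by [].
move=> p; apply/funext => q.
rewrite scalerA -rmorphM /= mulrACA !mulVf ?gt_eqF // mulr1.
by rewrite scale1r.
Qed.

(** Over a finite set c is bounded below, so dividing it out again shows that a
    kernel with a completely contractive scaling is completely bounded. *)
Lemma regularI (c : X -> R) : (forall x, 0 < c x <= 1) ->
  cc_kernel (scale_kernel c k) -> regular k.
Proof.
move=> c01 ck; split; last by exists c.
move=> n x x_inj.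
have c0 y : 0 < c y by case/andP: (c01 y).
(* The value 1 of the empty minimum keeps [a] positive when n = 0. *)
pose a := \big[Num.min/1]_i c (x i).
have a0 : 0 < a by apply: lt_bigmin.
apply: (@cb_bound_completely_bounded _ _ (a^-1 ^+ 4)).
  by rewrite exprn_ge0 // invr_ge0 ltW.
apply: (@cb_bound_unscale c) => // [i|]; first exact: bigmin_le.
by apply/completely_contractiveP; exact: ck.
Qed.

Lemma restrict_cc_kernel (h : opkernel X A B) (Y : set X) :
  cc_kernel h -> cc_kernel (restrict_kernel h Y).
Proof.
move=> hcc n x x_inj; apply: (hcc n (val \o x)).
exact: inj_comp val_inj x_inj.
Qed.

End Scaling.

Definition cb_bound_on (X : Type) (k : opkernel X A B) (Y : set X) (M : R) :=
  forall n (x : 'I_n -> X), injective x -> (forall i, Y (x i)) ->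
    cb_bound (entrywise k x) M.

Lemma cb_bound_le n (phi : 'M[A]_n -> 'M[B]_n) (M N : R) :
  M <= N -> cb_bound phi M -> cb_bound phi N.
Proof.
move=> MN phiM m T T1 H pi xi; apply: le_trans (phiM m T T1 H pi xi) _.
by apply: ler_wpM2r => //; apply: sumr_ge0 => *; rewrite sqr_ge0.
Qed.

(** Dividing by c >= a on both sides costs a factor a^-2 in cb-norm, the same for
    every finite subset of Y. *)
Lemma uniformly_regular_cb_bound (X : Type) (k : opkernel X A B) (Y : set X) :
  uniformly_regular (restrict_kernel k Y) ->
  exists N : nat, cb_bound_on k Y N.+1%:R.
Proof.
move=> [_ [a [/andP[a0 _] [c [ac ck]]]]].
exists (Num.Def.archi_bound (a^-1 ^+ 4)) => n x x_inj xY.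
apply: (@cb_bound_le _ _ (a^-1 ^+ 4)).
  apply: ltW; apply: lt_trans (_ : _ < (Num.Def.archi_bound (a^-1 ^+ 4))%:R) _.
    by apply: archi_boundP; rewrite exprn_ge0 // invr_ge0 ltW.
  by rewrite ltr_nat.
pose y i : Y := SigSub (mem_set (xY i)).
have y_inj : injective y by move=> i j /(congr1 val); exact: x_inj.
apply: (@cb_bound_unscale _ (restrict_kernel k Y) c a _ y a0).
  by move=> i; case/andP: (ac (y i)).
by apply/completely_contractiveP; exact: ck.
Qed.

(** [mxbound_weight] applied to the matrices over the kernel: enumerating the
    points of level at most N turns the compression to these levels into a matrix
    over the kernel on a smaller finite set, and compressing the argument T does
    not increase its norm. *)
Lemma weighted_cc_kernel (X : Type) (k : opkernel X A B) (lev : X -> nat) :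
  (forall N, cb_bound_on k [set x | (lev x <= N)%N] N.+1%:R) ->
  cc_kernel (scale_kernel (fun x => weight R (lev x)) k).
Proof.
move=> kN n x x_inj; apply/completely_contractiveP => m T T1.
rewrite mxflat_scale_kernel.
apply: (@mxbound_weight _ _ _ _ (fun p => lev (x p.2))) => N.
pose D := [set i | (lev (x i) <= N)%N]%SET.
pose e (p : 'I_m * 'I_#|D|) : 'I_m * 'I_n := (p.1, enum_val p.2).
have e_inj : injective e.
  by move=> [p i] [q j] [-> /enum_val_inj ->].
have -> : [set p : 'I_m * 'I_n | (lev (x p.2) <= N)%N]%SET =
    (e @: [set: 'I_m * 'I_#|D|])%SET.
  apply/setP => -[p i]; rewrite finset.inE /=; apply/idP/imsetP => [iN|].
    have iD : i \in D by rewrite finset.inE.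
    exists (p, enum_rank_in iD i); first by rewrite finset.in_setT.
    by rewrite /e /= enum_rankK_in.
  by move=> [[q j] _ [_ ->]]; have := enum_valP j; rewrite finset.inE.
apply/(mxbound_reindex _ _ e_inj).
pose T' : 'M['M[A]_#|D|]_m :=
  \matrix_(p, q) \matrix_(i, j) mxflat T (e (p, i)) (e (q, j)).
have -> : (fun p q => mxflat (map_mx (entrywise k x) T) (e p) (e q)) =
    mxflat (map_mx (entrywise k (x \o enum_val)) T').
  by apply/funext => p; apply/funext => q; rewrite /mxflat !mxE.
apply: kN => [|i|]; first exact: inj_comp x_inj enum_val_inj.
  by have := enum_valP i; rewrite finset.inE.
apply/(cstar_mxnorm_leP _ ler01).
have -> : (fun p q => T' p.1 q.1 p.2 q.2) = (fun p q => mxflat T (e p) (e q)).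
  by apply/funext => p; apply/funext => q; rewrite !mxE; case: p; case: q.
apply/(mxbound_reindex _ _ e_inj); apply: (mxbound_mono (finset.subsetT _)).
exact/cstar_mxnorm_leP.
Qed.

(** * Chains of uniformly regular sets *)

Lemma finite_chain_max (T : Type) (C0 : set (set T)) n (Y : 'I_n.+1 -> set T) :
  total_on C0 subset -> (forall i, C0 (Y i)) ->
  exists i0, forall i, Y i `<=` Y i0.
Proof.
move=> C0tot; elim: n Y => [|n IH] Y YC.
  by exists ord0 => i; rewrite (ord1 i).
have [j Yj] := IH (Y \o lift ord0) (fun i => YC _).
have [Y0|Y0] := C0tot _ _ (YC ord0) (YC (lift ord0 j)).
  exists (lift ord0 j) => i; case: (unliftP ord0 i) => [i' ->|-> //]; exact: Yj.
exists ord0 => i; case: (unliftP ord0 i) => [i' ->|-> //].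
exact: subset_trans (Yj i') Y0.
Qed.

(** A member of the chain and a bound valid on it, the level, are chosen for each
    point. Points of level at most N lie in the largest of the finitely many
    members chosen for them; this member was chosen for one of these points, so
    its squared bound is at most N + 1. *)
Lemma chain_regular (X : Type) (k : opkernel X A B) (C0 : set (set X)) :
  (forall Y, C0 Y -> uniformly_regular (restrict_kernel k Y)) ->
  total_on C0 subset -> \bigcup_(Y in C0) Y = setT -> regular k.
Proof.
move=> C0reg C0tot C0cov.
have /choice[f fP] (x : X) : exists YN : set X * nat,
    [/\ C0 YN.1, YN.1 x & cb_bound_on k YN.1 YN.2.+1%:R].
  have : (\bigcup_(Y in C0) Y) x by rewrite C0cov.
  move=> [Y YC Yx]; have [N kY] := uniformly_regular_cb_bound (C0reg _ YC).
  by exists (Y, N).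
apply: (@regularI _ _ (fun x => weight R (f x).2)).
  by move=> x; exact: weight_itv.
apply: weighted_cc_kernel => N [|n] x x_inj xN.
  (* No point, hence no member of the chain, but all sums are empty. *)
  move=> m T _ H pi xi; rewrite big1 => [|[? []] //].
  by rewrite mulr_ge0 ?sumr_ge0 // => *; rewrite sqr_ge0.
have fC i : C0 (f (x i)).1 by case: (fP (x i)).
have [i0 Yi0] := finite_chain_max C0tot fC.
have [_ _ kY] := fP (x i0).
apply: (@cb_bound_le _ _ (f (x i0)).2.+1%:R).
  by rewrite ler_nat ltnS; exact: xN.
apply: kY => // i; apply: (Yi0 i); by case: (fP (x i)).
Qed.

Lemma superlevel_uniformly_regular (X : Type) (k : opkernel X A B)
    (c : X -> R) (a : R) :
  (forall x, 0 < c x <= 1) -> cc_kernel (scale_kernel c k) -> 0 < a <= 1 ->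
  uniformly_regular (restrict_kernel k [set x | a <= c x]).
Proof.
move=> c01 ck a01; set Y := [set x | _].
have ckY : cc_kernel (scale_kernel (c \o val) (restrict_kernel k Y)).
  exact: (restrict_cc_kernel (Y := Y) ck).
split; first by apply: regularI ckY => y; exact: c01.
exists a; split=> //; exists (c \o val); split=> // y.
have /set_mem := valP y; rewrite /Y /= => ->.
by case/andP: (c01 (val y)).
Qed.

End Kernels.

Theorem lemma7p2 (R : realType) (X : Type) (A B : cstarAlgType R)
    (k : opkernel X A B) :
  let C := [set Y : set X | uniformly_regular (restrict_kernel k Y)] in
  (exists C0 : set (set X),
      [/\ C0 `<=` C, total_on C0 subset & \bigcup_(Y in C0) Y = setT])
  <-> regular k.
Proof.
move=> C; split=> [[C0 [C0C C0tot C0cov]]|[_ [c [c01 ck]]]].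
  exact: chain_regular C0C C0tot C0cov.
exists [set Y | exists2 a : R, 0 < a <= 1 & Y = [set x | a <= c x]]; split.
- by move=> _ [a a01 ->]; exact: superlevel_uniformly_regular.
- move=> _ _ [a _ ->] [b _ ->].
  by have [ab|/ltW ba] := leP b a; [left|right] => x /=; exact: le_trans.
- apply/seteqP; split=> // x _; exists [set y | c x <= c y] => //=.
  by exists (c x).
Qed.
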